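(* Let $m$ and $n$ be natural numbers with $m\ne n$, and let $a_1,a_2,\ldots$ be a harmonic progression whose $m$th term is $a_m=n$ and whose $n$th term is $a_n=m$. Then (a) $a_{m+n}=\dfrac{mn}{m+n}$; (b) $a_k=\dfrac{mn}{k}$ for every natural number $k$.
   Context: A sequence of (necessarily nonzero) real numbers $a_1,a_2,\ldots$ is a harmonic progression if the sequence of reciprocals $\frac1{a_1},\frac1{a_2},\ldots$ is an arithmetic progression, i.e. there is a fixed real $d$ with $\frac{1}{a_{k+1}}=\frac1{a_k}+d$ for all $k$. Natural numbers are the positive integers. *)

(* Defs.v *)
From Stdlib Require Import Reals.
Open Scope R_scope.

(* A sequence a_1, a_2, ... is a function nat -> R of which only the values at
   positive indices matter; [a 0] is unconstrained. *)

Definition arithmetic_progression (a : nat -> R) : Prop :=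
  exists d : R, forall k : nat, (1 <= k)%nat -> a (S k) = a k + d.

(* The nonvanishing clause is needed because [/ 0] is a total-function value
   here rather than undefined. *)
Definition harmonic_progression (a : nat -> R) : Prop :=
  (forall k : nat, (1 <= k)%nat -> a k <> 0) /\
  arithmetic_progression (fun k => / a k).

(* Main.v *)
Require Import Defs.
From Stdlib Require Import Reals Lra Lia.
Open Scope R_scope.

(** The reciprocals [/ a k] form an affine function [c + k d] of the index
    ([arithmetic_progression_affine]).  It takes the value [1/n] at [m] and
    [1/m] at [n], and so does the linear function [k / (m n)].  Since [m <> n],
    two values determine an affine function, so [c = 0] and [d = 1 / (m n)];
    inverting gives [a k = m n / k], of which the formula for [a (m + n)] is an
    instance. *)

Lemma arithmetic_progression_affine (b : nat -> R) :
  arithmetic_progression b ->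
  exists c d : R, forall k : nat, (1 <= k)%nat -> b k = c + INR k * d.
Proof.
  intros [d Hd].
  exists (b 1%nat - d), d.
  intros k Hk; induction Hk as [|k Hk IH].
  - simpl; ring.
  - rewrite Hd, IH, S_INR by exact Hk; ring.
Qed.

Lemma affine_swapped_reciprocals (x y c d : R) :
  x <> 0 -> y <> 0 -> x <> y ->
  c + x * d = / y -> c + y * d = / x ->
  c = 0 /\ d = / (x * y).
Proof.
  intros Hx Hy Hxy Ex Ey.
  assert (Hd : d = / (x * y)).
  { apply Rmult_eq_reg_l with (x - y); [|lra].
    replace ((x - y) * d) with (/ y - / x) by lra.
    field; split; assumption. }
  split; [|exact Hd].
  replace c with (/ y - x * d) by lra.
  rewrite Hd; field; split; assumption.
Qed.

Theorem mainTheorem4 :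
  forall (m n : nat) (a : nat -> R),
    (1 <= m)%nat -> (1 <= n)%nat -> m <> n ->
    harmonic_progression a ->
    a m = INR n ->
    a n = INR m ->
    a (m + n)%nat = INR m * INR n / (INR m + INR n) /\
    (forall k : nat, (1 <= k)%nat -> a k = INR m * INR n / INR k).
Proof.
  intros m n a Hm Hn Hmn [_ Hap] Eam Ean.
  destruct (arithmetic_progression_affine _ Hap) as [c [d Haff]].
  assert (Hm0 : INR m <> 0) by (apply not_0_INR; lia).
  assert (Hn0 : INR n <> 0) by (apply not_0_INR; lia).
  destruct (affine_swapped_reciprocals (INR m) (INR n) c d) as [Hc Hd];
    [exact Hm0 | exact Hn0 | now apply not_INR | | |].
  { now rewrite <- Haff, Eam. }
  { now rewrite <- Haff, Ean. }
  assert (Hterm : forall k : nat, (1 <= k)%nat -> a k = INR m * INR n / INR k).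
  { intros k Hk.
    assert (Hk0 : INR k <> 0) by (apply not_0_INR; lia).
    rewrite <- (Rinv_inv (a k)), (Haff k Hk), Hc, Hd.
    field; repeat split; assumption. }
  split; [|exact Hterm].
  rewrite <- plus_INR; apply Hterm; lia.
Qed.
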